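(* In the setting of the context (with $g$ unimodal, symmetric about $0$ and logconcave), the frequentist coverage $C(\theta)$ is nonincreasing (decreasing) in $\theta$ on the interval $(d_1,2d_0)$.
   Context: Let $g$ be a probability density on $\mathbb{R}$, unimodal and symmetric about $0$ (i.e. $g(z)=g(-z)$ and $g$ nonincreasing on $[0,\infty)$), and logconcave ($\log g$ concave on its support), with cdf $G$ and quantile function $G^{-1}(t)=\inf\{x:G(x)\ge t\}$. Let $X$ have density $g(x-\theta)$, $\theta\ge0$, and $P_\theta$ the corresponding probability. Fix $\alpha\in(0,1)$, and set $d_0=G^{-1}(\tfrac1{1+\alpha})$, $d_1=G^{-1}(1-\tfrac\alpha2)$. The HPD credible interval (prior $1_{[0,\infty)}(\theta)$, credibility $1-\alpha$) is $[l(X),u(X)]$ with $l(x)=\{x-G^{-1}(\tfrac12+\tfrac{1-\alpha}2G(x))\}1_{(d_0,\infty)}(x)$, $u(x)=x-G^{-1}(\alpha G(x))$ for $x\le d_0$ and $u(x)=x+G^{-1}(\tfrac12+\tfrac{1-\alpha}2G(x))$ for $x>d_0$. The frequentist coverage is $C(\theta)=P_\theta(l(X)\le\theta\le u(X))$. *)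

(* Defs.v *)
From Stdlib Require Import Reals Lra.
Open Scope R_scope.

Definition improper_integral (f : R -> R) (c : R) : Prop :=
  (forall a b : R, inhabited (Riemann_integrable f a b)) /\
  (forall eps : R, 0 < eps -> exists M : R,
     forall (a b : R) (pr : Riemann_integrable f a b),
       a <= - M -> M <= b -> Rabs (RiemannInt pr - c) < eps).

Definition is_density (g : R -> R) : Prop :=
  (forall x, 0 <= g x) /\ improper_integral g 1.

Definition is_cdf (g G : R -> R) : Prop :=
  (forall (a b : R) (pr : Riemann_integrable g a b),
      a <= b -> RiemannInt pr = G b - G a) /\
  (forall eps : R, 0 < eps -> exists M : R,
      forall x, x <= - M -> Rabs (G x) < eps).

Definition symmetric (g : R -> R) : Prop := forall z, g z = g (- z).

Definition nonincreasing_on_nonneg (g : R -> R) : Prop :=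
  forall x y, 0 <= x -> x <= y -> g y <= g x.

Definition logconcave (g : R -> R) : Prop :=
  forall x y lam, 0 < g x -> 0 < g y -> 0 <= lam <= 1 ->
    0 < g (lam * x + (1 - lam) * y) /\
    lam * ln (g x) + (1 - lam) * ln (g y) <= ln (g (lam * x + (1 - lam) * y)).

Definition is_glb (E : R -> Prop) (m : R) : Prop :=
  (forall x, E x -> m <= x) /\ (forall m', (forall x, E x -> m' <= x) -> m' <= m).

Definition is_quantile (G Qinv : R -> R) : Prop :=
  forall t, 0 < t < 1 -> is_glb (fun x => t <= G x) (Qinv t).

Definition hpd_d0 (Qinv : R -> R) (alpha : R) : R := Qinv (1 / (1 + alpha)).
Definition hpd_d1 (Qinv : R -> R) (alpha : R) : R := Qinv (1 - alpha / 2).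

(* HPD credible interval [l x, u x]. *)
Definition hpd_l (G Qinv : R -> R) (alpha x : R) : R :=
  if Rlt_dec (hpd_d0 Qinv alpha) x
  then x - Qinv (1/2 + (1 - alpha) / 2 * G x)
  else 0.

Definition hpd_u (G Qinv : R -> R) (alpha x : R) : R :=
  if Rle_dec x (hpd_d0 Qinv alpha)
  then x - Qinv (alpha * G x)
  else x + Qinv (1/2 + (1 - alpha) / 2 * G x).

(* Integrand of the coverage: density of X under theta times the indicator
   of the event {l(X) <= theta <= u(X)}. *)
Definition coverage_integrand (g G Qinv : R -> R) (alpha theta : R) (x : R) : R :=
  g (x - theta) *
  (if Rle_dec (hpd_l G Qinv alpha x) theta
   then if Rle_dec theta (hpd_u G Qinv alpha x) then 1 else 0
   else 0).

(* Main.v *)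
(** Write k = (1 - alpha) / 2. For th in (d1, 2 d0) the event l(X) <= th <= u(X)
    is, up to its endpoints, a <= X <= b with 0 < a <= d0 < th < b,
    G(a - th) = alpha G(a) and G(b - th) = 1/2 + k G(b), so the coverage is
    1/2 + k G(b) - alpha G(a). Put y = th - a and z = b - th. When th increases
    by h, so do a and b; since g decreases on the positive axis, k G(b) grows by
    at most h k g(b) / (1 - k g(b) / g(z)), and alpha G(a) by at least
    h alpha g(y) / (1 - alpha). Logconcavity bounds g(b) / g(z), by comparing the
    masses of [-a, z] and of its translate [y, b], and, when z < y, it bounds
    g(z) / g(y) by monotonicity of the hazard rate. The resulting inequality
    between the two growths holds with enough slack to absorb the discretization
    error of every step h below a uniform threshold, so neither derivatives nor
    continuity of g are needed. *)

Require Import Defs.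
From Stdlib Require Import Reals Lra ClassicalEpsilon.
From Coquelicot Require Import Coquelicot.
Open Scope R_scope.

Section SymmetricLogconcaveLaw.

Context (g G : R -> R) (Hdens : is_density g) (Hsym : symmetric g)
  (Hunimodal : nonincreasing_on_nonneg g) (Hlogc : logconcave g)
  (HG : is_cdf g G).

(** * Masses of intervals, bounds, limits and symmetry of the cdf *)

Lemma g_ge0 x : 0 <= g x.
Proof. now destruct Hdens as [H _]. Qed.

Lemma g_nonincreasing_abs x y : Rabs x <= Rabs y -> g y <= g x.
Proof.
  assert (E : forall t, g t = g (Rabs t)).
  { intro t. unfold Rabs. destruct (Rcase_abs t); [apply Hsym | easy]. }
  intro H. rewrite (E x), (E y). apply Hunimodal; [apply Rabs_pos | exact H].
Qed.

Lemma g_le_g0 x : g x <= g 0.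
Proof. apply g_nonincreasing_abs. rewrite Rabs_R0. apply Rabs_pos. Qed.

Lemma g_is_RInt a b : is_RInt g a b (G b - G a).
Proof.
  destruct Hdens as [_ [Hint _]], HG as [Hcdf _].
  assert (H : forall x y, x <= y -> is_RInt g x y (G y - G x)).
  { intros x y Hxy. destruct (Hint x y) as [pr].
    rewrite <- (Hcdf x y pr Hxy). apply ex_RInt_Reals_aux_1. }
  destruct (Rle_dec a b) as [Hab | Hab]; [now apply H |].
  replace (G b - G a) with (opp (G a - G b)) by (unfold opp; simpl; ring).
  apply (is_RInt_swap g), H. lra.
Qed.

Lemma g_shift_is_RInt v a b :
  is_RInt (fun s => g (s + v)) a b (G (b + v) - G (a + v)).
Proof.
  apply is_RInt_ext with (fun s => scal 1 (g (1 * s + v))).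
  { intros x _. unfold scal; simpl; unfold mult; simpl.
    rewrite Rmult_1_l. f_equal. ring. }
  apply (is_RInt_comp_lin g 1 v a b).
  rewrite !Rmult_1_l. apply g_is_RInt.
Qed.

(** Turns a pointwise comparison of [g] with its translate by [v] into a comparison of masses; the
    logconcavity estimates are integrated in this way. *)
Lemma G_shift_compare c1 c2 v a b : a <= b ->
  (forall s, a < s < b -> c1 * g s <= c2 * g (s + v)) ->
  c1 * (G b - G a) <= c2 * (G (b + v) - G (a + v)).
Proof.
  intros Hab H.
  apply (is_RInt_le (fun s => scal c1 (g s)) (fun s => scal c2 (g (s + v))) a b).
  - exact Hab.
  - apply (is_RInt_scal g), g_is_RInt.
  - apply (is_RInt_scal (fun s => g (s + v))), g_shift_is_RInt.
  - exact H.
Qed.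

Lemma G_increment_ge m a b : a <= b ->
  (forall s, a < s < b -> m <= g s) -> m * (b - a) <= G b - G a.
Proof.
  intros Hab H. rewrite Rmult_comm.
  apply (is_RInt_le (fun _ => m) g a b _ _ Hab (is_RInt_const a b m)
           (g_is_RInt a b) H).
Qed.

Lemma G_increment_le m a b : a <= b ->
  (forall s, a < s < b -> g s <= m) -> G b - G a <= m * (b - a).
Proof.
  intros Hab H. rewrite (Rmult_comm m).
  apply (is_RInt_le g (fun _ => m) a b _ _ Hab (g_is_RInt a b)
           (is_RInt_const a b m) H).
Qed.

Lemma G_nondecreasing a b : a <= b -> G a <= G b.
Proof.
  intro Hab.
  pose proof (G_increment_ge 0 a b Hab (fun s _ => g_ge0 s)). lra.
Qed.

Lemma G_lipschitz a b : a <= b -> G b - G a <= g 0 * (b - a).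
Proof.
  intro Hab. apply G_increment_le; [exact Hab |]. intros; apply g_le_g0.
Qed.

(** Otherwise the Lipschitz bound makes [G] constant, against total mass 1. *)
Lemma g0_gt0 : 0 < g 0.
Proof.
  destruct (Rle_lt_or_eq_dec 0 (g 0) (g_ge0 0)) as [H | H]; [exact H |].
  destruct Hdens as [_ [Hint Hlim]].
  destruct (Hlim 1 Rlt_0_1) as [M HM].
  pose proof (Rle_abs M).
  destruct (Hint (- Rabs M) (Rabs M)) as [pr].
  specialize (HM _ _ pr ltac:(lra) ltac:(lra)).
  pose proof (Rabs_pos M).
  destruct HG as [Hcdf _]. rewrite Hcdf in HM by lra.
  pose proof (G_lipschitz (- Rabs M) (Rabs M) ltac:(lra)) as HL.
  pose proof (G_nondecreasing (- Rabs M) (Rabs M) ltac:(lra)).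
  rewrite <- H in HL. apply Rabs_def2 in HM. lra.
Qed.

Lemma G_continuous : continuity G.
Proof.
  intros x eps Heps. pose proof g0_gt0 as H0.
  exists (eps / g 0). split; [now apply Rdiv_lt_0_compat |].
  intros y [_ Hy]. simpl in *. unfold Rdist in *.
  assert (Hy' : g 0 * Rabs (y - x) < eps).
  { apply Rmult_lt_compat_l with (1 := H0) in Hy.
    replace (g 0 * (eps / g 0)) with eps in Hy by (field; lra). exact Hy. }
  destruct (Rle_dec x y) as [H | H].
  - pose proof (G_nondecreasing x y H). pose proof (G_lipschitz x y H).
    rewrite Rabs_pos_eq in * by lra. lra.
  - pose proof (G_nondecreasing y x ltac:(lra)).
    pose proof (G_lipschitz y x ltac:(lra)).
    rewrite Rabs_left in Hy' by lra. rewrite Rabs_left1 by lra. lra.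
Qed.

Lemma G_le_1 x : G x <= 1.
Proof.
  apply Rnot_lt_le. intro Hx.
  destruct Hdens as [_ [Hint Hlim]], HG as [Hcdf Hm].
  (* One third of the excess pays for the mass of [-K, K] and one for [G (- K)], so [G K] stays
     below [G x]. *)
  set (e := (G x - 1) / 3). assert (He : 0 < e) by (unfold e; lra).
  destruct (Hlim e He) as [M HM], (Hm e He) as [N HN].
  set (K := Rabs M + Rabs N + Rabs x).
  assert (M <= K /\ N <= K /\ x <= K /\ 0 <= K) as (? & ? & ? & ?).
  { unfold K. pose proof (Rle_abs M). pose proof (Rle_abs N).
    pose proof (Rle_abs x). pose proof (Rabs_pos M).
    pose proof (Rabs_pos N). pose proof (Rabs_pos x). lra. }
  destruct (Hint (- K) K) as [pr].
  specialize (HM _ _ pr ltac:(lra) ltac:(lra)).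
  rewrite Hcdf in HM by lra. specialize (HN (- K) ltac:(lra)).
  apply Rabs_def2 in HM. apply Rabs_def2 in HN.
  pose proof (G_nondecreasing x K ltac:(lra)). unfold e in *. lra.
Qed.

Lemma G_tends_to_1 eps : 0 < eps -> exists M, forall x, M <= x -> 1 - eps < G x.
Proof.
  intro Heps.
  destruct Hdens as [_ [Hint Hlim]], HG as [Hcdf Hm].
  set (e := eps / 3). assert (He : 0 < e) by (unfold e; lra).
  destruct (Hlim e He) as [M HM], (Hm e He) as [N HN].
  set (K := Rabs M + Rabs N).
  assert (M <= K /\ N <= K /\ 0 <= K) as (? & ? & ?).
  { unfold K. pose proof (Rle_abs M). pose proof (Rle_abs N).
    pose proof (Rabs_pos M). pose proof (Rabs_pos N). lra. }
  exists K. intros x Hx.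
  destruct (Hint (- K) K) as [pr].
  specialize (HM _ _ pr ltac:(lra) ltac:(lra)).
  rewrite Hcdf in HM by lra. specialize (HN (- K) ltac:(lra)).
  apply Rabs_def2 in HM. apply Rabs_def2 in HN.
  pose proof (G_nondecreasing K x ltac:(lra)). unfold e in *. lra.
Qed.


(** Reflection reverses the increments of [G], so G(-x) + G(x) is constant in x; letting x tend to
    infinity gives the constant 1. *)
Lemma G_opp x : G (- x) = 1 - G x.
Proof.
  assert (Hinc : forall a b, G (- b) - G (- a) = - (G b - G a)).
  { intros a b.
    assert (H : is_RInt g a b (opp (G (- b) - G (- a)))).
    { apply is_RInt_ext with (fun y => opp (opp (g (- y)))).
      - intros t _. unfold opp; simpl. rewrite Ropp_involutive.
        symmetry; apply Hsym.
      - apply (is_RInt_opp (fun y => opp (g (- y)))).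
        apply (is_RInt_comp_opp g), g_is_RInt. }
    apply (@is_RInt_unique R_CompleteNormedModule) in H.
    rewrite (is_RInt_unique _ _ _ _ (g_is_RInt a b)) in H.
    unfold opp in H; simpl in H. lra. }
  assert (Hc : forall eps, 0 < eps -> Rabs (G (- x) + G x - 1) < eps).
  { intros eps Heps. set (e := eps / 3).
    assert (He : 0 < e) by (unfold e; lra).
    destruct (G_tends_to_1 e He) as [M HM].
    destruct HG as [_ Hm]. destruct (Hm e He) as [N HN].
    set (K := Rmax M N). specialize (HM K (Rmax_l _ _)).
    specialize (HN (- K) ltac:(pose proof (Rmax_r M N); unfold K; lra)).
    pose proof (Hinc x K). pose proof (G_le_1 K). apply Rabs_def2 in HN.
    apply Rabs_def1; unfold e in *; lra. }
  destruct (Req_dec (G (- x) + G x - 1) 0) as [H | H]; [lra |].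
  specialize (Hc _ (Rabs_pos_lt _ H)). lra.
Qed.

Lemma G_0 : G 0 = 1 / 2.
Proof. pose proof (G_opp 0) as H. rewrite Ropp_0 in H. lra. Qed.

Lemma G_ge_0 x : 0 <= G x.
Proof. pose proof (G_opp x). pose proof (G_le_1 (- x)). lra. Qed.

(** A zero of [g] at [x] would persist to the right by unimodality and freeze [G] below its limit
    1. *)
Lemma g_gt0_of_G_lt1 x : 0 <= x -> G x < 1 -> 0 < g x.
Proof.
  intros Hx H1.
  destruct (Rle_lt_or_eq_dec 0 (g x) (g_ge0 x)) as [H | H]; [exact H |].
  destruct (G_tends_to_1 (1 - G x) ltac:(lra)) as [M HM].
  specialize (HM (Rmax M x) (Rmax_l _ _)).
  pose proof (Rmax_r M x).
  assert (G (Rmax M x) - G x <= 0 * (Rmax M x - x)); [| lra].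
  apply G_increment_le; [easy |].
  intros s Hs. rewrite H. apply Hunimodal; lra.
Qed.

(** At the midpoint [m], either [G m] has already reached 1, or [g m] is positive and bounds [g]
    from below on [x, m]. *)
Lemma G_strict x y : 0 <= x -> x < y -> G x < 1 -> G x < G y.
Proof.
  intros Hx Hxy H1.
  set (m := (x + y) / 2).
  destruct (Rlt_le_dec (G m) 1) as [Hm | Hm].
  - pose proof (g_gt0_of_G_lt1 m ltac:(unfold m; lra) Hm) as Hg.
    assert (g m * (m - x) <= G m - G x).
    { apply G_increment_ge; [unfold m; lra |]. intros; apply Hunimodal; lra. }
    pose proof (G_nondecreasing m y ltac:(unfold m; lra)).
    assert (0 < g m * (m - x)) by (apply Rmult_lt_0_compat; unfold m in *; lra).
    lra.
  - pose proof (G_nondecreasing m y ltac:(unfold m; lra)). lra.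
Qed.

Lemma G_reflects_lt x y : G x < G y -> x < y.
Proof.
  intro H. apply Rnot_le_lt. intro H'. pose proof (G_nondecreasing y x H'). lra.
Qed.

Lemma G_reflects_le x y : 1 / 2 < G y -> G y < 1 -> G x <= G y -> x <= y.
Proof.
  intros H2 H1 H. apply Rnot_lt_le. intro Hyx.
  assert (0 <= y) by (apply Rlt_le, G_reflects_lt; rewrite G_0; exact H2).
  pose proof (G_strict y x). lra.
Qed.

(** * Consequences of logconcavity *)

(** The inner points [y] and [x + t] are convex combinations of the outer points [x] and [y + t]
    with exchanged weights, so the two logconcavity inequalities add up. It says that g(s + t) /
    g(s) is nonincreasing in s. *)
Lemma g_four_point x y t : x <= y -> 0 <= t -> g x * g (y + t) <= g (x + t) * g y.
Proof.
  intros Hxy Ht.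
  destruct (Rle_lt_or_eq_dec 0 (g x) (g_ge0 x)) as [Hx | Hx];
    [| rewrite <- Hx, Rmult_0_l; apply Rmult_le_pos; apply g_ge0].
  destruct (Rle_lt_or_eq_dec 0 (g (y + t)) (g_ge0 (y + t))) as [Hy | Hy];
    [| rewrite <- Hy, Rmult_0_r; apply Rmult_le_pos; apply g_ge0].
  destruct (Req_dec (y + t - x) 0) as [E | E].
  { replace y with x by lra. replace t with 0 by lra.
    rewrite Rplus_0_r. lra. }
  (* The weight of [x] in [y]; the weight of [x] in [x + t] is [1 - lam]. *)
  set (lam := t / (y + t - x)).
  assert (Hd : 0 < y + t - x) by lra.
  assert (Hlam : 0 <= lam <= 1).
  { unfold lam. split.
    - apply Rdiv_le_0_compat; lra.
    - apply Rmult_le_reg_r with (y + t - x); [lra |].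
      unfold Rdiv. rewrite Rmult_assoc, Rinv_l; lra. }
  destruct (Hlogc x (y + t) lam Hx Hy Hlam) as [P1 L1].
  destruct (Hlogc x (y + t) (1 - lam) Hx Hy ltac:(lra)) as [P2 L2].
  replace (lam * x + (1 - lam) * (y + t)) with y in P1, L1
    by (unfold lam; field; lra).
  replace ((1 - lam) * x + (1 - (1 - lam)) * (y + t)) with (x + t) in P2, L2
    by (unfold lam; field; lra).
  apply Rnot_lt_le. intro H.
  apply ln_increasing in H; [| now apply Rmult_lt_0_compat].
  rewrite !ln_mult in H by assumption. lra.
Qed.

(** This is monotonicity of the hazard rate g / (1 - G), with denominators cleared. The four-point
    inequality is integrated from [u] to a far point, and the neglected tail costs at most [eps]. *)
Lemma hazard_nondecreasing t u : t <= u -> g t * (1 - G u) <= g u * (1 - G t).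
Proof.
  intro Htu. apply le_epsilon. intros eps Heps.
  set (e := eps / (g 0 + 1)). pose proof g0_gt0 as H0.
  assert (He : 0 < e) by (apply Rdiv_lt_0_compat; lra).
  destruct (G_tends_to_1 e He) as [M HM].
  set (N := Rmax M t). pose proof (Rmax_r M t : t <= N) as HtN.
  assert (Hs : g t * (G (N + (u - t)) - G (t + (u - t))) <= g u * (G N - G t)).
  { assert (g t * (G (N + (u - t)) - G (t + (u - t))) <=
            g u * (G (N + (u - t) + (t - u)) - G (t + (u - t) + (t - u)))) as H'.
    { apply G_shift_compare; [lra |]. intros s Hs.
      pose proof (g_four_point t (s + (t - u)) (u - t) ltac:(lra) ltac:(lra)) as F.
      replace (s + (t - u) + (u - t)) with s in F by ring.
      replace (t + (u - t)) with u in F by ring. exact F. }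
    replace (N + (u - t) + (t - u)) with N in H' by ring.
    replace (t + (u - t) + (t - u)) with t in H' by ring. exact H'. }
  replace (t + (u - t)) with u in Hs by ring.
  pose proof (Rmax_l M t : M <= N) as HMN.
  pose proof (HM (N + (u - t)) ltac:(lra)) as H1.
  pose proof (G_le_1 N).
  pose proof (g_ge0 t). pose proof (g_ge0 u). pose proof (g_le_g0 t).
  assert (g t * e <= eps).
  { replace eps with ((g 0 + 1) * e) by (unfold e; field; lra).
    apply Rmult_le_compat_r; lra. }
  assert (g u * (G N - G t) <= g u * (1 - G t)) by (apply Rmult_le_compat_l; lra).
  assert (g t * (1 - G u) <= g t * (G (N + (u - t)) - G u + e))
    by (apply Rmult_le_compat_l; lra).
  lra.
Qed.

(** The cdf inherits logconcavity, so G(x - t) / G(x) is nondecreasing in x; here it is compared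
    with its value at 0. This serves to exclude negative observations from the coverage event. *)
Lemma G_ratio_shift x t : x <= 0 -> 0 <= t -> 0 < g x ->
  G (x - t) * G 0 <= G (- t) * G x.
Proof.
  intros Hx Ht Hgx.
  pose proof (hazard_nondecreasing (- x) (- x + t) ltac:(lra)) as H1.
  rewrite <- Hsym in H1.
  replace (- x + t) with (- (x - t)) in H1 by ring.
  rewrite !G_opp, <- Hsym in H1.
  assert (H2 : g (x - t) * (G 0 - G x) <= g x * (G (0 + - t) - G (x + - t))).
  { apply G_shift_compare; [lra |]. intros s Hs.
    pose proof (g_four_point (x - t) (s - t) t ltac:(lra) Ht) as F.
    replace (x - t + t) with x in F by ring.
    replace (s - t + t) with s in F by ring. exact F. }
  replace (0 + - t) with (- t) in H2 by ring.
  replace (x + - t) with (x - t) in H2 by ring.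
  pose proof (G_nondecreasing x 0 Hx). pose proof (G_ge_0 x).
  apply Rmult_le_reg_l with (g x); [exact Hgx |].
  assert (g x * G (x - t) * (G 0 - G x) <= g (x - t) * G x * (G 0 - G x))
    by (apply Rmult_le_compat_r; lra).
  assert (G x * (g (x - t) * (G 0 - G x)) <= G x * (g x * (G (- t) - G (x - t))))
    by (apply Rmult_le_compat_l; lra).
  lra.
Qed.

(** * The quantile function as an inverse of the cdf *)

Context (Qinv : R -> R) (alpha : R) (HQ : is_quantile G Qinv)
  (Halpha : 0 < alpha < 1).

(** The infimum is attained: if G(y) < t, the Lipschitz bound keeps [G] below [t] a little beyond
    [y], which gives a larger lower bound. *)
Lemma Qinv_le_iff t y : 0 < t < 1 -> Qinv t <= y <-> t <= G y.
Proof.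
  intro Ht. destruct (HQ t Ht) as [Hlb Hglb]. split.
  - intro Hy. apply Rnot_lt_le. intro Hlt. pose proof g0_gt0 as H0.
    set (e := (t - G y) / 2 / g 0).
    assert (He : 0 < e) by (apply Rdiv_lt_0_compat; lra).
    assert (y + e <= Qinv t); [| lra].
    apply Hglb. intros x Hx. apply Rlt_le, G_reflects_lt.
    pose proof (G_lipschitz y (y + e) ltac:(lra)) as HL.
    replace (g 0 * (y + e - y)) with ((t - G y) / 2) in HL
      by (unfold e; field; lra).
    lra.
  - apply Hlb.
Qed.

Lemma G_Qinv t : 0 < t < 1 -> G (Qinv t) = t.
Proof.
  intro Ht. apply Rle_antisym.
  - apply Rnot_lt_le. intro Hlt. pose proof g0_gt0 as H0.
    set (e := (G (Qinv t) - t) / g 0).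
    assert (He : 0 < e) by (apply Rdiv_lt_0_compat; lra).
    assert (Qinv t <= Qinv t - e); [| lra].
    apply Qinv_le_iff; [exact Ht |].
    pose proof (G_lipschitz (Qinv t - e) (Qinv t) ltac:(lra)) as HL.
    replace (g 0 * (Qinv t - (Qinv t - e))) with (G (Qinv t) - t) in HL
      by (unfold e; field; lra).
    lra.
  - apply Qinv_le_iff; [exact Ht | apply Rle_refl].
Qed.

Lemma le_Qinv_iff t y : 1 / 2 < t < 1 -> y <= Qinv t <-> G y <= t.
Proof.
  intro Ht. pose proof (G_Qinv t ltac:(lra)) as E. split; intro H.
  - rewrite <- E. now apply G_nondecreasing.
  - apply G_reflects_le; lra.
Qed.

(** * The thresholds and the endpoints of the coverage event *)

Let d0 := hpd_d0 Qinv alpha.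
Let d1 := hpd_d1 Qinv alpha.
Let k := (1 - alpha) / 2.

Lemma inv_1_alpha_bounds : 1 / 2 < 1 / (1 + alpha) < 1 - alpha / 2.
Proof.
  assert (H : 1 / (1 + alpha) * (1 + alpha) = 1) by (field; lra).
  set (r := 1 / (1 + alpha)) in *. split; nra.
Qed.

Lemma G_d0 : G d0 = 1 / (1 + alpha).
Proof. pose proof inv_1_alpha_bounds. apply G_Qinv. lra. Qed.

Lemma G_d1 : G d1 = 1 - alpha / 2.
Proof. apply G_Qinv. lra. Qed.

Lemma d0_gt0 : 0 < d0.
Proof.
  apply G_reflects_lt. rewrite G_0, G_d0. apply inv_1_alpha_bounds.
Qed.

Lemma d0_lt_d1 : d0 < d1.
Proof. apply G_reflects_lt. rewrite G_d0, G_d1. apply inv_1_alpha_bounds. Qed.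

Lemma G_gt_d1 x : d1 < x -> 1 - alpha / 2 < G x.
Proof.
  intro Hx. pose proof d0_gt0. pose proof d0_lt_d1.
  rewrite <- G_d1. apply G_strict; [lra | exact Hx |]. rewrite G_d1. lra.
Qed.

(* [a] and [b] are the solutions of u(a) = th and l(b) = th, written without
   quantiles. *)
Definition lower_cut (th a : R) : Prop :=
  0 < a <= d0 /\ G (a - th) = alpha * G a.

Definition upper_cut (th b : R) : Prop :=
  th < b /\ G (b - th) = 1 / 2 + k * G b.

(* G is concave on [0, oo) and convex on (-oo, 0], so x |-> G (x - th) - alpha G x
   is convex on [0, d0]; being negative at 0, it changes sign once. *)
Lemma lower_sign_change th x y : d1 < th -> 0 < x < y -> y <= d0 ->
  alpha * G x <= G (x - th) -> alpha * G y < G (y - th).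
Proof.
  intros Hth Hxy Hy Hx. pose proof d0_lt_d1. pose proof (G_gt_d1 th Hth).
  pose proof (G_opp th) as Hop. pose proof G_0 as HG0.
  assert (Hin : forall s t, 0 <= s <= t -> g t * (t - s) <= G t - G s).
  { intros s t Hst. apply G_increment_ge; [lra |].
    intros r Hr. apply Hunimodal; lra. }
  assert (Hin' : forall s t, 0 <= s <= t -> G t - G s <= g s * (t - s)).
  { intros s t Hst. apply G_increment_le; [lra |].
    intros r Hr. apply Hunimodal; lra. }
  pose proof (Hin 0 x ltac:(lra)) as I1.
  pose proof (Hin' x y ltac:(lra)) as I2.
  pose proof (Hin' (th - x) th ltac:(lra)) as I3.
  pose proof (Hin (th - y) (th - x) ltac:(lra)) as I4.
  replace (x - th) with (- (th - x)) in * by ring.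
  replace (y - th) with (- (th - y)) in * by ring.
  rewrite G_opp in *.
  replace (th - (th - x)) with x in I3 by ring.
  replace (th - x - (th - y)) with (y - x) in I4 by ring.
  rewrite Rminus_0_r, HG0 in I1.
  (* The convex function is negative at 0, since [th] exceeds [d1], and nonnegative at [x]. Its
     slope at [x] is therefore positive, which is the inequality asserted. *)
  assert (Hg : alpha * g x < g (th - x)).
  { apply Rmult_lt_reg_r with x; [lra |].
    assert (alpha * (g x * x) <= alpha * (G x - 1 / 2))
      by (apply Rmult_le_compat_l; lra).
    lra. }
  assert (alpha * (G y - G x) <= alpha * (g x * (y - x)))
    by (apply Rmult_le_compat_l; lra).
  assert (alpha * g x * (y - x) < g (th - x) * (y - x))
    by (apply Rmult_lt_compat_r; lra).
  lra.
Qed.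

(** To the right of [th], G(x - th) grows at least as fast as G(x) by unimodality; since k < 1, the
    difference G(x - th) - k G(x) is strictly increasing where G(x - th) < 1. *)
Lemma upper_sign_change th x y : th <= x < y ->
  1 / 2 + k * G x <= G (x - th) -> G (x - th) < 1 ->
  0 <= th ->
  1 / 2 + k * G y < G (y - th).
Proof.
  intros Hxy Hx H1 Hth.
  assert (Hk : 0 < k < 1) by (unfold k; lra).
  pose proof (G_strict (x - th) (y - th) ltac:(lra) ltac:(lra) H1) as Hs.
  assert (H : 1 * (G y - G x) <= 1 * (G (y + - th) - G (x + - th))).
  { apply G_shift_compare; [lra |]. intros s Hs'. rewrite !Rmult_1_l.
    apply Hunimodal; lra. }
  change (y + - th) with (y - th) in H. change (x + - th) with (x - th) in H.
  pose proof (G_nondecreasing x y ltac:(lra)).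
  assert (k * (G y - G x) <= k * (G (y - th) - G (x - th)))
    by (apply Rmult_le_compat_l; lra).
  assert (0 < (1 - k) * (G (y - th) - G (x - th)))
    by (apply Rmult_lt_0_compat; lra).
  lra.
Qed.

(** Intermediate values on [0, d0]: the sign at 0 comes from [th] exceeding [d1], the sign at [d0]
    from th < 2 d0 and the identity G(-d0) = alpha G(d0) that characterizes the level of [d0]. *)
Lemma lower_cut_exists th : d1 < th < 2 * d0 -> exists a, lower_cut th a.
Proof.
  intro Hth. pose proof d0_gt0. pose proof (G_gt_d1 th ltac:(lra)).
  assert (Hc : continuity (fun x => G (x - th) - alpha * G x)).
  { pose proof G_continuous as HGc. intro x.
    apply continuity_pt_minus.
    - apply (continuity_pt_comp (fun x => x - th) G); [| apply HGc].
      apply continuity_pt_minus; [apply continuity_pt_id |].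
      apply continuity_pt_const. now intros ? ?.
    - apply continuity_pt_scal, HGc. }
  assert (Hneg : G (0 - th) - alpha * G 0 < 0).
  { rewrite Rminus_0_l, G_opp, G_0. lra. }
  assert (Hpos : 0 <= G (d0 - th) - alpha * G d0).
  { pose proof (G_nondecreasing (- d0) (d0 - th) ltac:(lra)) as Hm.
    rewrite G_opp, G_d0 in Hm. rewrite G_d0.
    replace (1 - 1 / (1 + alpha)) with (alpha * (1 / (1 + alpha))) in Hm
      by (field; lra). lra. }
  destruct (IVT_cor _ 0 d0 Hc ltac:(lra)) as [a [Ha Ea]].
  { nra. }
  exists a. simpl in Ea. repeat split; [| lra | lra].
  destruct (Req_dec a 0) as [-> |]; lra.
Qed.

(** Intermediate values on [th, th + d1], where G(d1) = 1/2 + k dominates the right-hand side. *)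
Lemma upper_cut_exists th : 0 <= th -> exists b, upper_cut th b.
Proof.
  intro Hth. pose proof d0_gt0. pose proof d0_lt_d1.
  assert (Hc : continuity (fun x => G (x - th) - k * G x - 1 / 2)).
  { pose proof G_continuous as HGc. intro x.
    apply continuity_pt_minus;
      [apply continuity_pt_minus | apply continuity_pt_const; now intros ? ?].
    - apply (continuity_pt_comp (fun x => x - th) G); [| apply HGc].
      apply continuity_pt_minus; [apply continuity_pt_id |].
      apply continuity_pt_const. now intros ? ?.
    - apply continuity_pt_scal, HGc. }
  assert (Hk : 0 < k) by (unfold k; lra).
  assert (Hneg : G (th - th) - k * G th - 1 / 2 < 0).
  { pose proof (G_nondecreasing 0 th Hth). rewrite G_0 in *.
    replace (th - th) with 0 by ring. rewrite G_0. nra. }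
  assert (Hpos : 0 <= G (th + d1 - th) - k * G (th + d1) - 1 / 2).
  { replace (th + d1 - th) with d1 by ring. rewrite G_d1.
    assert (k * G (th + d1) <= k * 1)
      by (apply Rmult_le_compat_l; [lra | apply G_le_1]).
    unfold k in *. lra. }
  destruct (IVT_cor _ th (th + d1) Hc ltac:(lra)) as [b [Hb Eb]].
  { nra. }
  exists b. simpl in Eb. split; [| lra].
  destruct (Req_dec b th) as [-> |]; lra.
Qed.

(** * The coverage as the mass between the two cuts *)

(** Up to [d0] the lower bound is 0 and only u(x) >= th matters, which [a] decides. Beyond [d0] the
    upper bound always exceeds or equals [th], because th < 2 d0, and only l(x) <= th matters, which
    [b] decides. *)
Lemma coverage_integrand_cuts th a b : d1 < th < 2 * d0 ->
  lower_cut th a -> upper_cut th b ->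
  forall x,
  (a < x < b -> coverage_integrand g G Qinv alpha th x = g (x - th)) /\
  (x < a \/ b < x -> coverage_integrand g G Qinv alpha th x = 0).
Proof.
  intros Hth [Ha Ea] [Hb Eb] x. pose proof d0_gt0. pose proof d0_lt_d1.
  pose proof inv_1_alpha_bounds as Hinv. pose proof G_d0 as Hd0.
  assert (Hk : 0 < k < 1) by (unfold k; lra).
  pose proof (G_le_1 x) as Hx1. pose proof (G_ge_0 x) as Hx0.
  unfold coverage_integrand, hpd_l, hpd_u. fold d0 k.
  destruct (Rle_dec x d0) as [Hx | Hx].
  - destruct (Rlt_dec d0 x) as [Hx' | _]; [lra |].
    destruct (Rle_dec 0 th) as [_ | Hn]; [| lra].
    split.
    + intros [Hax _]. pose proof (G_nondecreasing 0 x ltac:(lra)) as Hm.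
      rewrite G_0 in Hm.
      destruct (Rle_dec th (x - Qinv (alpha * G x))) as [_ | Hn]; [ring |].
      exfalso. apply Hn.
      assert (Qinv (alpha * G x) <= x - th); [| lra].
      apply Qinv_le_iff; [nra |].
      apply Rlt_le, lower_sign_change with a; lra.
    + intros [Hax | Hbx]; [| lra].
      (* In the left tail [G x] may be 0, where the quantile is unspecified; then [g (x - th)] is 0
         as well. A positive [g (x - th)] puts the level in (0, 1). *)
      destruct (Rle_lt_or_eq_dec 0 (g (x - th)) (g_ge0 _)) as [Hg | Hg];
        [| rewrite <- Hg; ring].
      destruct (Rle_dec th (x - Qinv (alpha * G x))) as [Hn |]; [| ring].
      exfalso.
      assert (HQ' : Qinv (alpha * G x) <= x - th) by lra.
      destruct (Rle_lt_dec x 0) as [Hxn | Hxp].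
      * assert (Hgx : 0 < g x).
        { apply Rlt_le_trans with (1 := Hg), g_nonincreasing_abs.
          rewrite !Rabs_left1; lra. }
        assert (HGx : 0 < G x).
        { assert (g (x - th) * (x - (x - th)) <= G x - G (x - th)).
          { apply G_increment_ge; [lra |]. intros s Hs.
            apply g_nonincreasing_abs. rewrite !Rabs_left1; lra. }
          pose proof (G_ge_0 (x - th)).
          assert (0 < g (x - th) * (x - (x - th)))
            by (apply Rmult_lt_0_compat; lra).
          lra. }
        apply Qinv_le_iff in HQ'; [| nra].
        pose proof (G_ratio_shift x th Hxn ltac:(lra) Hgx) as HR.
        pose proof (G_gt_d1 th ltac:(lra)) as Hd.
        rewrite G_opp, G_0 in HR. nra.
      * pose proof (G_nondecreasing 0 x ltac:(lra)) as Hm. rewrite G_0 in Hm.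
        apply Qinv_le_iff in HQ'; [| nra].
        pose proof (lower_sign_change th x a ltac:(lra) ltac:(lra) ltac:(lra)
                      HQ'). lra.
  - destruct (Rlt_dec d0 x) as [_ | Hx']; [| lra].
    pose proof (G_nondecreasing d0 x ltac:(lra)) as Hm.
    (* The level of [d0] is the fixed point of p |-> 1/2 + k p. *)
    assert (Ht : 1 / (1 + alpha) <= 1 / 2 + k * G x < 1).
    { split.
      - replace (1 / (1 + alpha)) with (1 / 2 + k * (1 / (1 + alpha)))
          by (unfold k; field; lra).
        rewrite <- Hd0. apply Rplus_le_compat_l, Rmult_le_compat_l; lra.
      - unfold k in *. nra. }
    destruct (Rle_dec th (x + Qinv (1 / 2 + k * G x))) as [_ | Hn].
    2:{ exfalso. apply Hn. assert (th - x <= Qinv (1 / 2 + k * G x)); [| lra].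
        apply le_Qinv_iff; [lra |].
        pose proof (G_nondecreasing (th - x) d0 ltac:(lra)). lra. }
    assert (Hl : x - Qinv (1 / 2 + k * G x) <= th <->
                 G (x - th) <= 1 / 2 + k * G x).
    { rewrite <- le_Qinv_iff by lra. lra. }
    pose proof (G_le_1 b) as Hb1.
    assert (HGb : G (b - th) < 1) by (unfold k in *; nra).
    split.
    + intros [_ Hxb].
      destruct (Rle_dec (x - Qinv (1 / 2 + k * G x)) th) as [_ | Hn]; [ring |].
      exfalso. apply Hn, Hl, Rnot_lt_le. intro Hgt.
      destruct (Rle_lt_dec x th) as [Hxt | Hxt].
      { pose proof (G_nondecreasing (x - th) 0 ltac:(lra)) as Hm'.
        rewrite G_0 in Hm'. lra. }
      pose proof (G_nondecreasing (x - th) (b - th) ltac:(lra)).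
      pose proof (upper_sign_change th x b ltac:(lra) ltac:(lra) ltac:(lra)
                    ltac:(lra)). lra.
    + intros [Hxa | Hxb]; [lra |].
      destruct (Rle_dec (x - Qinv (1 / 2 + k * G x)) th) as [Hn |]; [| ring].
      apply Hl in Hn.
      pose proof (upper_sign_change th b x ltac:(lra) ltac:(lra) ltac:(lra)
                    ltac:(lra)). lra.
Qed.

(** The values of [f] at [a] and [b] are left free, as they do not affect the integral. *)
Lemma improper_integral_interval (f : R -> R) v a b : a <= b ->
  (forall x, (a < x < b -> f x = g (x - v)) /\ (x < a \/ b < x -> f x = 0)) ->
  improper_integral f (G (b - v) - G (a - v)).
Proof.
  intros Hab Hf.
  assert (Hint : forall A B, A <= a -> b <= B ->
                 is_RInt f A B (G (b - v) - G (a - v))).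
  { intros A B HA HB.
    assert (I1 : is_RInt f A a (scal (a - A) 0)).
    { apply is_RInt_ext with (fun _ => 0); [| apply (is_RInt_const A a 0)].
      intros x. rewrite Rmin_left, Rmax_right by lra. intro.
      symmetry; apply Hf; lra. }
    assert (I2 : is_RInt f a b (G (b + - v) - G (a + - v))).
    { apply is_RInt_ext with (fun s => g (s + - v)); [| apply g_shift_is_RInt].
      intros x. rewrite Rmin_left, Rmax_right by lra. intro.
      symmetry; apply Hf; lra. }
    assert (I3 : is_RInt f b B (scal (B - b) 0)).
    { apply is_RInt_ext with (fun _ => 0); [| apply (is_RInt_const b B 0)].
      intros x. rewrite Rmin_left, Rmax_right by lra. intro.
      symmetry; apply Hf; lra. }
    pose proof (is_RInt_Chasles f _ _ _ _ _
                  (is_RInt_Chasles f _ _ _ _ _ I1 I2) I3) as I.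
    unfold plus, scal in I; simpl in I; unfold mult in I; simpl in I.
    replace (G (b - v) - G (a - v))
      with ((a - A) * 0 + (G (b + - v) - G (a + - v)) + (B - b) * 0)
      by (unfold Rminus; ring).
    exact I. }
  split.
  - intros A B. constructor. apply ex_RInt_Reals_0.
    assert (Hex : forall A B, A <= B -> ex_RInt f A B).
    { clear A B. intros A B HAB.
      (* Integrability on [A, B] is inherited from a larger interval containing [a, b]. *)
      apply (ex_RInt_Chasles_2 f (Rmin A a) A B).
      { split; [apply Rmin_l | exact HAB]. }
      apply (ex_RInt_Chasles_1 f (Rmin A a) B (Rmax B b)).
      { split; [| apply Rmax_l]. pose proof (Rmin_l A a). lra. }
      exists (G (b - v) - G (a - v)).
      apply Hint; [apply Rmin_r | apply Rmax_r]. }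
    destruct (Rle_dec A B); [now apply Hex |].
    apply ex_RInt_swap, Hex. lra.
  - intros eps Heps. exists (Rmax (- a) b). intros A B pr HA HB.
    pose proof (Rmax_l (- a) b). pose proof (Rmax_r (- a) b).
    rewrite <- RInt_Reals.
    rewrite (is_RInt_unique _ _ _ _ (Hint A B ltac:(lra) ltac:(lra))).
    replace (_ - _) with 0 by ring. now rewrite Rabs_R0.
Qed.

(** * Comparison of the coverage at two nearby parameters *)

(** Raising [th] lowers G(a1 - th), so at [th2] the sign at [a1] is not positive, whereas the sign
    change at [a2] would make it positive if a2 < a1. *)
Lemma lower_cut_nondecreasing th1 th2 a1 a2 : d1 < th1 <= th2 ->
  lower_cut th1 a1 -> lower_cut th2 a2 -> a1 <= a2.
Proof.
  intros Hth [Ha1 E1] [Ha2 E2]. apply Rnot_lt_le. intro H.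
  pose proof (G_nondecreasing (a1 - th2) (a1 - th1) ltac:(lra)).
  pose proof (lower_sign_change th2 a2 a1 ltac:(lra) ltac:(lra) ltac:(lra)
                ltac:(lra)). lra.
Qed.

Lemma upper_cut_G_lt1 th b : upper_cut th b -> G (b - th) < 1.
Proof. intros [_ E]. pose proof (G_le_1 b). unfold k in E. nra. Qed.

Lemma upper_cut_nondecreasing th1 th2 b1 b2 : 0 <= th1 <= th2 ->
  upper_cut th1 b1 -> upper_cut th2 b2 -> b1 <= b2.
Proof.
  intros Hth [Hb1 E1] Hc2. pose proof (upper_cut_G_lt1 _ _ Hc2) as Hlt.
  destruct Hc2 as [Hb2 E2]. apply Rnot_lt_le. intro H.
  pose proof (G_nondecreasing (b1 - th2) (b1 - th1) ltac:(lra)).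
  pose proof (upper_sign_change th2 b2 b1 ltac:(lra) ltac:(lra) ltac:(lra)
                ltac:(lra)). lra.
Qed.

(* Here p = G(a), p' is p up to the discretization error, q = G(b), while gb, gz
   and gy stand for g at b, b - th and th - a. *)
Lemma density_inequality p p' q gb gz gy :
  1 / 2 <= p -> p - (1 - alpha) / 8 <= p' -> 1 - alpha / 2 <= q <= 1 ->
  0 <= gb -> 0 < gz -> 0 < gy ->
  gb * (k * q - 1 / 2 + p') <= gz * (q - 1 + alpha * p) ->
  gz <= gy \/
  (1 / 2 + k * q <= 1 - alpha * p /\
   gz * (alpha * p) <= gy * (1 / 2 - k * q)) ->
  (1 - alpha) * (k * (gb * gz)) <= alpha * (gy * (gz - k * gb)).
Proof.
  intros Hp Hp' Hq Hgb Hgz Hgy Hratio Hcase.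
  assert (Hk : k = (1 - alpha) / 2) by reflexivity. clearbody k.
  set (D := k * q - 1 / 2 + p') in *. set (N := q - 1 + alpha * p) in *.
  assert (HD : 0 < D).
  { unfold D. subst k.
    assert ((1 - alpha) / 2 * (1 - alpha / 2) <= (1 - alpha) / 2 * q)
      by (apply Rmult_le_compat_l; lra). nra. }
  assert (HkN : k * gb * D <= k * (gz * N)).
  { rewrite Rmult_assoc. apply Rmult_le_compat_l; [subst k; lra | exact Hratio]. }
  destruct Hcase as [Hzy | [Hzy Hhaz]].
  (* When gz <= gy, the weaker bound k gb <= alpha gz suffices. *)
  - assert (HND : k * N <= alpha * D).
    { assert (0 <= (1 - alpha) * k * (1 - q))
        by (apply Rmult_le_pos; [apply Rmult_le_pos |]; subst k; lra).
      assert (0 <= alpha * (p' - alpha / 2 - k * p))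
        by (apply Rmult_le_pos; subst k; nra).
      assert (alpha * D - k * N =
              (1 - alpha) * k * (1 - q) + alpha * (p' - alpha / 2 - k * p))
        by (unfold D, N; subst k; field).
      lra. }
    assert (Hb : k * gb <= alpha * gz).
    { apply Rmult_le_reg_r with D; [exact HD |].
      assert (gz * (k * N) <= gz * (alpha * D))
        by (apply Rmult_le_compat_l; lra). lra. }
    assert (gy * ((1 - alpha) * gz) <= gy * (gz - k * gb))
      by (apply Rmult_le_compat_l; lra).
    assert ((1 - alpha) * gz * gz <= (1 - alpha) * gz * gy)
      by (apply Rmult_le_compat_l; [apply Rmult_le_pos |]; lra).
    assert ((1 - alpha) * gz * (k * gb) <= (1 - alpha) * gz * (alpha * gz))
      by (apply Rmult_le_compat_l; [apply Rmult_le_pos |]; lra).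
    nra.
  (* Here w / 2 is the tail 1 - G(z), and alpha p is the tail 1 - G(y). *)
  - set (w := 1 - 2 * k * q) in *.
    assert (Hw : 2 * alpha * p <= w) by (unfold w; lra).
    (* After [gz] is replaced by its hazard bound, [F] is the total coefficient of k gb, and the
       goal becomes k gb F <= alpha^2 p gz. *)
    set (F := (1 - alpha) * w / 2 + alpha * alpha * p).
    assert (Hap : 0 < alpha * p) by (apply Rmult_lt_0_compat; lra).
    assert (HF : 0 < F).
    { unfold F. assert (0 < alpha * alpha * p) by nra.
      assert (0 <= (1 - alpha) * w) by (apply Rmult_le_pos; lra). lra. }
    assert (Hpoly : k * N * F <= alpha * alpha * p * D).
    { assert (E : alpha * alpha * p * D - k * N * F =
        (w - 2 * alpha * p) * ((1 - alpha) / 4) *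
          (w + 2 * alpha * p - alpha - (1 - alpha) * (alpha * p))
        + alpha * alpha * p * (p' - 1 / 2 + p * (1 - alpha) / 2)).
      { unfold F, D, N, w. subst k. field. }
      assert (0 <= (w - 2 * alpha * p) * ((1 - alpha) / 4) *
                (w + 2 * alpha * p - alpha - (1 - alpha) * (alpha * p))).
      { apply Rmult_le_pos; [apply Rmult_le_pos; lra |].
        assert (alpha * (1 / 2) <= alpha * p)
          by (apply Rmult_le_compat_l; lra).
        assert (0 <= alpha * (alpha * p)) by (apply Rmult_le_pos; lra). lra. }
      assert (0 <= alpha * alpha * p * (p' - 1 / 2 + p * (1 - alpha) / 2)).
      { apply Rmult_le_pos; nra. }
      lra. }
    assert (Hb : k * gb * F <= alpha * alpha * p * gz).
    { apply Rmult_le_reg_r with D; [exact HD |].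
      assert (k * gb * D * F <= k * (gz * N) * F)
        by (apply Rmult_le_compat_r; lra).
      assert (gz * (k * N * F) <= gz * (alpha * alpha * p * D))
        by (apply Rmult_le_compat_l; lra). lra. }
    apply Rmult_le_reg_r with (alpha * p); [exact Hap |].
    assert (0 <= (1 - alpha) * (k * gb)).
    { apply Rmult_le_pos; [lra |]. apply Rmult_le_pos; subst k; lra. }
    assert ((1 - alpha) * (k * gb) * (gz * (alpha * p)) <=
            (1 - alpha) * (k * gb) * (gy * (1 / 2 - k * q)))
      by (apply Rmult_le_compat_l; lra).
    assert (gy * (k * gb * F) <= gy * (alpha * alpha * p * gz))
      by (apply Rmult_le_compat_l; lra).
    unfold F, w in *. lra.
Qed.

(** By the cut equations the coverage changes by [mz - my], the growth of k G(b) minus that of alpha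
    G(a). The step bound keeps the error in [G] below (1 - alpha) / 8. *)
Lemma coverage_step th1 th2 a1 a2 b1 b2 :
  d1 < th1 < th2 -> 2 * (th2 - th1) * g 0 <= (1 - alpha) / 8 ->
  lower_cut th1 a1 -> lower_cut th2 a2 -> upper_cut th1 b1 -> upper_cut th2 b2 ->
  G (b2 - th2) - G (a2 - th2) <= G (b1 - th1) - G (a1 - th1).
Proof.
  intros Hth Hsmall La1 La2 Ub1 Ub2.
  pose proof d0_gt0 as Hd0. pose proof d0_lt_d1 as Hd1.
  pose proof (lower_cut_nondecreasing th1 th2 a1 a2 ltac:(lra) La1 La2) as Ha12.
  pose proof (upper_cut_nondecreasing th1 th2 b1 b2 ltac:(lra) Ub1 Ub2) as Hb12.
  pose proof (upper_cut_G_lt1 _ _ Ub2) as Hz2lt.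
  destruct La1 as [Ha1 Ea1], La2 as [Ha2 Ea2], Ub1 as [Hb1 Eb1], Ub2 as [Hb2 Eb2].
  assert (Hk : 0 < k < 1) by (unfold k; lra).
  set (h := th2 - th1).
  set (y1 := th1 - a1). set (y2 := th2 - a2).
  set (z1 := b1 - th1). set (z2 := b2 - th2).
  fold z1 in Eb1. fold z2 in Eb2, Hz2lt. fold z1 z2.
  pose proof Ea1 as Ey1. pose proof Ea2 as Ey2.
  replace (a1 - th1) with (- y1) in Ey1 by (unfold y1; ring).
  replace (a2 - th2) with (- y2) in Ey2 by (unfold y2; ring).
  rewrite G_opp in Ey1, Ey2.
  pose proof (G_nondecreasing a1 a2 Ha12) as HGa.
  pose proof (G_nondecreasing b1 b2 Hb12) as HGb.
  pose proof (G_nondecreasing 0 a1 ltac:(lra)) as HGa1. rewrite G_0 in HGa1.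
  pose proof (G_nondecreasing a2 d0 ltac:(lra)) as HGa2. rewrite G_d0 in HGa2.
  pose proof (G_le_1 b2) as HGb2.
  pose proof (G_gt_d1 b1 ltac:(lra)) as HGb1.
  pose proof inv_1_alpha_bounds as Hinv.
  assert (HaG : alpha * G a1 <= alpha * G a2) by (apply Rmult_le_compat_l; lra).
  assert (HkG : k * G b1 <= k * G b2) by (apply Rmult_le_compat_l; lra).
  assert (HaGa2 : alpha * G a2 <= 1 - 1 / (1 + alpha)).
  { replace (1 - 1 / (1 + alpha)) with (alpha * (1 / (1 + alpha)))
      by (field; lra). apply Rmult_le_compat_l; lra. }
  assert (HaGa1 : 0 < alpha * G a1) by (apply Rmult_lt_0_compat; lra).
  assert (Hy2d : d0 <= y2) by (apply G_reflects_le; rewrite ?G_d0; lra).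
  assert (Hy12 : y2 <= y1) by (apply G_reflects_le; lra).
  assert (Hkp : 0 < k * G b1) by (apply Rmult_lt_0_compat; lra).
  assert (Hz12 : z1 <= z2) by (apply G_reflects_le; lra).
  assert (Hz1 : 0 < z1) by (unfold z1; lra).
  (* G(z2) is at most 1/2 + k = G(d1), which is below G(b1). *)
  assert (Hz2b : z2 <= b1).
  { apply Rlt_le, G_reflects_lt. unfold k in *. nra. }
  set (gb := g b1). set (gz := g z2). set (gy := g y2).
  assert (Hgz : 0 < gz) by (apply g_gt0_of_G_lt1; lra).
  assert (Hgy : 0 < gy) by (apply g_gt0_of_G_lt1; lra).
  assert (Hgb : 0 <= gb <= gz).
  { split; [apply g_ge0 | apply Hunimodal; lra]. }
  assert (Mz1 : gz * (z2 - z1) <= G z2 - G z1).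
  { apply G_increment_ge; [lra |]. intros; apply Hunimodal; lra. }
  assert (Mb : G b2 - G b1 <= gb * (b2 - b1)).
  { apply G_increment_le; [lra |]. intros; apply Hunimodal; lra. }
  (* [gy] is a lower bound here because a2 <= d0 <= y2. *)
  assert (Ma : gy * (a2 - a1) <= G a2 - G a1).
  { apply G_increment_ge; [lra |]. intros; apply Hunimodal; lra. }
  assert (My : G y1 - G y2 <= gy * (y1 - y2)).
  { apply G_increment_le; [lra |]. intros; apply Hunimodal; lra. }
  assert (Dz : b2 - b1 = h + (z2 - z1)) by (unfold h, z1, z2; ring).
  assert (Da : a2 - a1 = h + (y1 - y2)) by (unfold h, y1, y2; ring).
  assert (Hh : 0 < h) by (unfold h; lra).
  set (mz := G z2 - G z1) in *. set (my := G y1 - G y2) in *.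
  assert (Emz : mz = k * (G b2 - G b1)) by (unfold mz; lra).
  assert (Emy : my = alpha * (G a2 - G a1)) by (unfold my; lra).
  (* The growth of b is h plus that of z, itself at most mz / gz; the resulting implicit bound is
     solved for [mz]. The next assertion solves for [my] likewise. *)
  assert (Hz : mz * (gz - k * gb) <= k * gb * gz * h).
  { rewrite Dz in Mb.
    assert (mz <= k * (gb * (h + (z2 - z1))))
      by (rewrite Emz; apply Rmult_le_compat_l; lra).
    assert (gz * mz <= gz * (k * (gb * (h + (z2 - z1)))))
      by (apply Rmult_le_compat_l; lra).
    assert (k * gb * (gz * (z2 - z1)) <= k * gb * mz)
      by (apply Rmult_le_compat_l; [apply Rmult_le_pos |]; lra).
    lra. }
  assert (Hy : alpha * gy * h <= (1 - alpha) * my).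
  { rewrite Da in Ma.
    assert (alpha * (gy * (h + (y1 - y2))) <= my)
      by (rewrite Emy; apply Rmult_le_compat_l; lra).
    assert (alpha * my <= alpha * (gy * (y1 - y2)))
      by (apply Rmult_le_compat_l; lra).
    lra. }
  (* As k <= 1/2, z grows at most half as much as b, so b2 - b1 <= 2 h; this is the factor 2 in the
     step bound. *)
  assert (Hdz : z2 - z1 <= h).
  { apply Rmult_le_reg_l with gz; [lra |].
    assert (k * gb <= k * gz) by (apply Rmult_le_compat_l; lra).
    assert (mz <= k * gb * (b2 - b1)).
    { rewrite Emz, Rmult_assoc. apply Rmult_le_compat_l; lra. }
    assert (k * gb * (b2 - b1) <= k * gz * (b2 - b1))
      by (apply Rmult_le_compat_r; lra).
    assert (k * (gz * (b2 - b1)) <= 1 / 2 * (gz * (b2 - b1))).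
    { apply Rmult_le_compat_r; [apply Rmult_le_pos; lra | unfold k; lra]. }
    rewrite Dz in *. lra. }
  (* g (s + t) / g s >= gb / gz for s <= z2; integrate over s in [y2 - t, z2],
     whose translate by t is [y2, b1]. *)
  assert (Hratio : gb * (k * G b2 - 1 / 2 + G (a2 - (b2 - b1))) <=
                   gz * (G b2 - 1 + alpha * G a2)).
  { set (t := b1 - z2).
    assert (Hp' : G (a2 - (b2 - b1)) = 1 - G (y2 - t)).
    { rewrite <- G_opp. f_equal. unfold y2, t, z2. ring. }
    rewrite Hp'.
    destruct (Rle_lt_dec (y2 - t) z2) as [Hs | Hs].
    - assert (gb * (G z2 - G (y2 - t)) <= gz * (G (z2 + t) - G (y2 - t + t))).
      { apply G_shift_compare; [exact Hs |]. intros s Hs'.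
        pose proof (g_four_point s z2 t ltac:(lra) ltac:(unfold t; lra)) as F.
        replace (z2 + t) with b1 in F by (unfold t; ring).
        fold gz gb in F. lra. }
      replace (z2 + t) with b1 in * by (unfold t; ring).
      replace (y2 - t + t) with y2 in * by ring.
      assert (gz * (G b1 - G y2) <= gz * (G b2 - 1 + alpha * G a2))
        by (apply Rmult_le_compat_l; lra).
      replace (k * G b2 - 1 / 2 + (1 - G (y2 - t))) with (G z2 - G (y2 - t))
        by lra.
      lra.
    - pose proof (G_nondecreasing z2 (y2 - t) ltac:(lra)).
      assert (0 <= gb * (G (y2 - t) - G z2)) by (apply Rmult_le_pos; lra).
      assert (0 <= gz * (G b2 - 1 + alpha * G a2)).
      { apply Rmult_le_pos; [lra |].
        assert (alpha * (1 / 2) <= alpha * G a2)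
          by (apply Rmult_le_compat_l; lra). lra. }
      replace (k * G b2 - 1 / 2 + (1 - G (y2 - t))) with (- (G (y2 - t) - G z2))
        by lra.
      lra. }
  assert (Hkey : (1 - alpha) * (k * (gb * gz)) <= alpha * (gy * (gz - k * gb))).
  { apply (density_inequality (G a2) (G (a2 - (b2 - b1))) (G b2)); try lra.
    - pose proof (G_lipschitz (a2 - (b2 - b1)) a2 ltac:(lra)) as HL.
      replace (a2 - (a2 - (b2 - b1))) with (b2 - b1) in HL by ring.
      assert (g 0 * (b2 - b1) <= g 0 * (2 * h)).
      { apply Rmult_le_compat_l; [apply g_ge0 | lra]. }
      unfold h in *. lra.
    - destruct (Rle_lt_dec gz gy) as [Hzy | Hzy]; [now left | right].
      assert (Hlt : z2 <= y2).
      { apply Rnot_lt_le. intro Hc.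
        pose proof (Hunimodal y2 z2 ltac:(lra) ltac:(lra)) as Hu.
        unfold gz, gy in Hzy. lra. }
      pose proof (G_nondecreasing z2 y2 Hlt).
      pose proof (hazard_nondecreasing z2 y2 Hlt) as Hhaz.
      fold gz gy in Hhaz.
      replace (1 - G y2) with (alpha * G a2) in Hhaz by lra.
      replace (1 - G z2) with (1 / 2 - k * G b2) in Hhaz by lra.
      split; [lra | exact Hhaz]. }
  assert (Hpos : 0 < gz - k * gb).
  { assert (k * gb <= k * gz) by (apply Rmult_le_compat_l; lra).
    assert (0 < (1 - k) * gz) by (apply Rmult_lt_0_compat; lra). lra. }
  assert (Hfin : mz <= my).
  { apply Rmult_le_reg_r with (gz - k * gb); [exact Hpos |].
    apply Rmult_le_reg_l with (1 - alpha); [lra |].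
    assert ((1 - alpha) * (mz * (gz - k * gb)) <= (1 - alpha) * (k * gb * gz * h))
      by (apply Rmult_le_compat_l; lra).
    assert ((1 - alpha) * (k * (gb * gz)) * h <= alpha * (gy * (gz - k * gb)) * h)
      by (apply Rmult_le_compat_r; lra).
    assert (alpha * gy * h * (gz - k * gb) <= (1 - alpha) * my * (gz - k * gb))
      by (apply Rmult_le_compat_r; lra).
    lra. }
  rewrite Ea1, Ea2. unfold mz in *. lra.
Qed.

End SymmetricLogconcaveLaw.

(** * From uniformly small steps to the whole interval *)

Lemma nonincreasing_of_small_steps (C : R -> R) (lo hi eps : R) : 0 < eps ->
  (forall s t, lo < s -> s < t -> t < hi -> t - s <= eps -> C t <= C s) ->
  forall s t, lo < s -> s <= t -> t < hi -> C t <= C s.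
Proof.
  intros Heps Hstep.
  assert (H : forall n s t, lo < s -> s <= t -> t < hi ->
                t - s <= INR n * eps -> C t <= C s).
  { induction n as [| n IH]; intros s t Hs Hst Ht Hn.
    - simpl in Hn. replace t with s by lra. apply Rle_refl.
    - rewrite S_INR in Hn.
      destruct (Rle_lt_dec (t - s) eps) as [Hle | Hgt].
      + destruct Hst as [Hst | ->]; [now apply Hstep | apply Rle_refl].
      + apply Rle_trans with (C (t - eps)).
        * apply Hstep; lra.
        * apply IH; lra. }
  intros s t Hs Hst Ht.
  destruct (INR_unbounded ((t - s) / eps)) as [n Hn].
  apply (H n); try assumption.
  apply Rmult_lt_compat_r with (r := eps) in Hn; [| exact Heps].
  unfold Rdiv in Hn. rewrite Rmult_assoc, Rinv_l in Hn; lra.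
Qed.

Theorem theorem1 (g G Qinv : R -> R) (alpha : R)
  (Hdens : is_density g)
  (Hsym : symmetric g)
  (Hunimodal : nonincreasing_on_nonneg g)
  (Hlogc : logconcave g)
  (HG : is_cdf g G)
  (HQ : is_quantile G Qinv)
  (Halpha : 0 < alpha < 1) :
  exists C : R -> R,
    (forall theta, hpd_d1 Qinv alpha < theta < 2 * hpd_d0 Qinv alpha ->
       improper_integral (coverage_integrand g G Qinv alpha theta) (C theta)) /\
    (forall theta1 theta2,
       hpd_d1 Qinv alpha < theta1 -> theta1 <= theta2 -> theta2 < 2 * hpd_d0 Qinv alpha ->
       C theta2 <= C theta1).
Proof.
  set (d0 := hpd_d0 Qinv alpha). set (d1 := hpd_d1 Qinv alpha).
  assert (Hd0 : 0 < d0) by (eapply d0_gt0; eassumption).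
  assert (Hd1 : d0 < d1) by (eapply d0_lt_d1; eassumption).
  assert (Hg0 : 0 < g 0) by (eapply g0_gt0; eassumption).
  (* Outside (d1, 2 d0) the cuts take the dummy value 0, so that choice yields total functions. *)
  assert (Ha : forall th, exists a, d1 < th < 2 * d0 ->
                 lower_cut G Qinv alpha th a).
  { intro th. destruct (classic (d1 < th < 2 * d0)) as [Hth | Hth].
    - destruct (lower_cut_exists g G Hdens Hsym Hunimodal HG
                  Qinv alpha HQ Halpha th Hth) as [a La]. now exists a.
    - now exists 0. }
  assert (Hb : forall th, exists b, d1 < th < 2 * d0 -> upper_cut G alpha th b).
  { intro th. destruct (classic (d1 < th < 2 * d0)) as [Hth | Hth].
    - destruct (upper_cut_exists g G Hdens Hsym Hunimodal HG
                  Qinv alpha HQ Halpha th ltac:(lra)) as [b Ub]. now exists b.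
    - now exists 0. }
  destruct (choice _ Ha) as [a La]. destruct (choice _ Hb) as [b Ub].
  exists (fun th => G (b th - th) - G (a th - th)). split.
  - intros th Hth. specialize (La th Hth). specialize (Ub th Hth).
    apply (improper_integral_interval g G Hdens HG).
    + destruct La as [La _], Ub as [Ub _]. fold d0 in La. lra.
    + now apply coverage_integrand_cuts.
  (* Chosen so that 2 eps g(0) = (1 - alpha) / 8, the bound required of a step. *)
  - set (eps := (1 - alpha) / (16 * g 0)).
    apply (nonincreasing_of_small_steps _ d1 (2 * d0) eps).
    + apply Rdiv_lt_0_compat; lra.
    + intros s t Hs Hst Ht Hle.
      eapply coverage_step; try eassumption;
        [split; assumption | | apply La; lra | apply La; lra
         | apply Ub; lra | apply Ub; lra].
      apply Rle_trans with (2 * eps * g 0).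
      * apply Rmult_le_compat_r; lra.
      * unfold eps. right. field. lra.
Qed.
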